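(* Let $(L,\leq,\wedge,\vee,0,1)$ be a complete lattice with bottom element $0$ and top element $1$, let $\{c_i\}_{i\in\mathbb{Z}}\subseteq L$ be a family with $c_i\leq c_{i+1}$ for all $i\in\mathbb{Z}$, let $c=\bigwedge_{i\in\mathbb{Z}}c_i$, and for each $i\in\mathbb{Z}$ let $T_i$ be a t-norm on the subinterval $[c_{i-1},c_i]$. Set $$A_1=\{x\in L\mid (\exists i\in\mathbb{Z})(x\in I_{c_i})\ \text{and}\ \inf\{i\in\mathbb{Z}\mid x\in I_{c_i}\}=-\infty\},\qquad A_2^i=\,]c_{i-1},1[\,\cap I_{c_i}\quad(i\in\mathbb{Z}),$$ $$\Delta_1=\left(A_1\times[0,1[\,\right)\cup\left([0,1[\,\times A_1\right),\qquad \Delta_2^i=\left(A_2^i\times[c_{i-1},1[\,\right)\cup\left([c_{i-1},1[\,\times A_2^i\right)\quad(i\in\mathbb{Z}).$$ Then the binary operation (ordinal sum) $T=\{\langle c_{i-1},c_i,T_i\rangle\}_{i\in\mathbb{Z}}\colon L\times L\to L$ given by $$T(x,y)=\begin{cases}T_i(x,y)&\text{if }(x,y)\in[c_{i-1},c_i]^2\text{ for some } i\in\mathbb{Z},\\ T_i(x\wedge c_i,\,y\wedge c_i)&\text{if }(x,y)\in\Delta_2^i\text{ for some } i\in\mathbb{Z},\\ x\wedge y\wedge c&\text{if }(x,y)\in\Delta_1,\\ x\wedge y&\text{otherwise,}\end{cases}$$ is a t-norm on $L$.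
   Context: For $a\leq b$ in a lattice $L$, $[a,b]=\{x\in L\mid a\leq x\leq b\}$; similarly $[a,b[\,=\{x\in L\mid a\leq x<b\}$ and $]a,b[\,=\{x\in L\mid a<x<b\}$, where $x<y$ means $x\leq y$ and $x\neq y$. For $a\in L$, $I_a$ denotes the set of all elements of $L$ incomparable with $a$, i.e. $x\in I_a$ iff neither $x\leq a$ nor $a\leq x$. A t-norm on a subinterval $[a,b]$ of $L$ is a binary operation $T\colon[a,b]\times[a,b]\to[a,b]$ such that for all $x,y,z\in[a,b]$: $T(x,y)=T(y,x)$; $x\leq y$ implies $T(x,z)\leq T(y,z)$; $T(T(x,y),z)=T(x,T(y,z))$; and $T(b,x)=x$. A t-norm on $L$ is a t-norm on $[0,1]=L$. *)

(* Defs.v *)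
From HB Require Import structures.
From mathcomp Require Import all_boot all_order all_algebra.
From mathcomp Require Import boolp classical_sets set_interval.
From mathcomp Require Import constructive_ereal.

Set Implicit Arguments.
Unset Strict Implicit.
Unset Printing Implicit Defensive.

Import Order.TTheory GRing.Theory.

Local Open Scope classical_set_scope.
Local Open Scope order_scope.

Definition complete_lattice (d : Order.disp_t) (L : tbLatticeType d) : Prop :=
  forall A : set L, supremums A !=set0 /\ infimums A !=set0.

Section Tnorm.
Context {d : Order.disp_t} {L : tbLatticeType d}.

(* An operation on [a, b] is represented by a total function on L that maps
   [a, b] x [a, b] into [a, b]; its values elsewhere are irrelevant. *)
Record is_tnorm_on (a b : L) (T : L -> L -> L) : Prop := IsTnormOn {
  tnorm_closed : forall x y, x \in `[a, b] -> y \in `[a, b] ->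
    T x y \in `[a, b];
  tnormC : forall x y, x \in `[a, b] -> y \in `[a, b] -> T x y = T y x;
  tnorm_le : forall x y z, x \in `[a, b] -> y \in `[a, b] -> z \in `[a, b] ->
    x <= y -> T x z <= T y z;
  tnormA : forall x y z, x \in `[a, b] -> y \in `[a, b] -> z \in `[a, b] ->
    T (T x y) z = T x (T y z);
  tnorm1 : forall x, x \in `[a, b] -> T b x = x
}.

Definition is_tnorm (T : L -> L -> L) : Prop := is_tnorm_on \bot \top T.

Definition incomparable_set (a : L) : set L := [set x | x >< a].

End Tnorm.

Section OrdinalSum.
Context {d : Order.disp_t} {L : tbLatticeType d}.
Variable c_ : int -> L.

(* The infimum of the index set is taken in \bar int, i.e. in the integers
   extended with -oo and +oo. *)
Definition A1 : set L :=
  [set x | (exists i : int, incomparable_set (c_ i) x) /\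
    infimums (EFin @` [set i : int | incomparable_set (c_ i) x]) (-oo)%E].

Definition A2 (i : int) : set L :=
  `]c_ (i - 1)%R, \top[%classic `&` incomparable_set (c_ i).

Definition Delta1 : set (L * L) :=
  (A1 `*` `[\bot, \top[%classic) `|` (`[\bot, \top[%classic `*` A1).

Definition Delta2 (i : int) : set (L * L) :=
  (A2 i `*` `[c_ (i - 1)%R, \top[%classic) `|`
  (`[c_ (i - 1)%R, \top[%classic `*` A2 i).

Definition square (i : int) : set (L * L) :=
  `[c_ (i - 1)%R, c_ i]%classic `*` `[c_ (i - 1)%R, c_ i]%classic.

(* T is the operation given by the case distinction. The first two clauses are
   required for every index i whose region contains (x, y), so existence of
   such a T expresses that the case distinction is unambiguous. *)
Record is_ordinal_sum (c : L) (T_ : int -> L -> L -> L) (T : L -> L -> L) :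
    Prop := IsOrdinalSum {
  ordinal_sum_square : forall i x y, square i (x, y) -> T x y = T_ i x y;
  ordinal_sum_Delta2 : forall i x y, Delta2 i (x, y) ->
    T x y = T_ i (x `&` c_ i) (y `&` c_ i);
  ordinal_sum_Delta1 : forall x y, Delta1 (x, y) -> T x y = x `&` y `&` c;
  ordinal_sum_otherwise : forall x y,
    ~ (exists i, square i (x, y)) -> ~ (exists i, Delta2 i (x, y)) ->
    ~ Delta1 (x, y) -> T x y = x `&` y
}.

End OrdinalSum.

(* Main.v *)
Require Import Defs.
From HB Require Import structures.
From mathcomp Require Import all_boot all_order all_algebra.
From mathcomp Require Import boolp classical_sets set_interval.
From mathcomp Require Import constructive_ereal.
From mathcomp Require Import zify.

Set Implicit Arguments.
Unset Strict Implicit.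
Unset Printing Implicit Defensive.

Local Open Scope classical_set_scope.
Local Open Scope order_scope.

(** Everything is decided by which of the [c_ i] lie below the meet
    [m = x `&` y].  Since [c_] is nondecreasing, these indices form an initial
    segment of the integers, so it is either empty, or everything, or of the
    form [{j | j <= i - 1}], in which case [m] is said to have level [i].  For
    [x, y < \top] the case distinction collapses to:
    - [T x y = x `&` y `&` c] if no [c_ i] lies below [m];
    - [T x y = T_ i (x `&` c_ i) (y `&` c_ i)] if [m] has level [i];
    - [T x y = x `&` y] if every [c_ i] lies below [m].

    This collapsed operation, [level_sum], is a function by construction, so
    once it satisfies every clause of the ordinal sum
    ([level_sum_ordinal_sum]) these clauses cannot conflict; as they cover all
    pairs, they determine it ([ordinal_sum_uniq]).

    It is a t-norm for the following reason.  The elements [T x y] and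
    [x `&` y] have the same [c_ i] below them ([cle_level_sum]); hence all ways
    of bracketing [x], [y], [z] fall under the same one of the three formulas,
    the one given by [x `&` y `&` z].  Moreover, if [c_ (i - 1)] lies below both
    [x] and [y], then truncating [T x y] at [c_ i] gives [T_ i] of the
    truncations of [x] and [y] ([level_sum_trunc]), and truncating at [c] makes
    [T x y] and [x `&` y] equal ([level_sum_meet_c]); so associativity reduces
    to that of [T_ i] or of the meet.  For monotonicity, the value at the
    smaller argument is given by one formula; by the same truncation lemmas that
    formula, evaluated at the larger argument, bounds the value there from
    below. *)

Import Order.TTheory.

(** * T-norms on an interval *)

Section TnormOn.
Context {d : Order.disp_t} {L : tbLatticeType d}.
Variables (a b : L) (T : L -> L -> L).
Hypotheses (le_ab : a <= b) (T_tnorm : is_tnorm_on a b T).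

Lemma tnorm_leI x y : x \in `[a, b] -> y \in `[a, b] -> T x y <= x `&` y.
Proof.
have leT u v : u \in `[a, b] -> v \in `[a, b] -> T u v <= v.
  move=> uab vab; rewrite -[leRHS](tnorm1 T_tnorm vab).
  apply: (tnorm_le T_tnorm) => //; first by rewrite in_itv /= le_ab lexx.
  by move: uab; rewrite in_itv /= => /andP[].
move=> xab yab; rewrite lexI (leT _ _ xab yab) andbT.
by rewrite (tnormC T_tnorm xab yab) leT.
Qed.

Lemma tnorm_lower_end : T a a = a.
Proof.
have aab : a \in `[a, b] by rewrite in_itv /= lexx le_ab.
apply/le_anti/andP; split; first by rewrite (le_trans (tnorm_leI _ _)) ?leIl.
by have := tnorm_closed T_tnorm aab aab; rewrite in_itv /= => /andP[].
Qed.

End TnormOn.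

Section LevelSum.
Context {d : Order.disp_t} {L : tbLatticeType d}.
Variable c_ : int -> L.
Hypothesis c_le : forall i : int, c_ i <= c_ (i + 1)%R.

(** * Levels of an element with respect to a nondecreasing family *)

Lemma chain_mono (i j : int) : i <= j -> c_ i <= c_ j.
Proof.
move=> ij; have -> : j = (i + `|j - i|%N%:Z)%R by lia.
elim: `|j - i|%N => [|n IHn]; first by rewrite GRing.addr0.
by apply: le_trans IHn _; rewrite -addn1 PoszD GRing.addrA.
Qed.

Lemma chain_pred_le (i : int) : c_ (i - 1)%R <= c_ i.
Proof. by apply: chain_mono; lia. Qed.

Lemma chain_trans (i j : int) (m : L) : i <= j -> c_ j <= m -> c_ i <= m.
Proof. by move=> /chain_mono; apply: le_trans. Qed.

Definition has_level (m : L) (i : int) : Prop :=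
  c_ (i - 1)%R <= m /\ ~~ (c_ i <= m).

Lemma has_level_lt (m : L) (i j : int) : has_level m i -> c_ j <= m -> j < i.
Proof.
move=> [_ /negP nci] cj; rewrite ltNge; apply/negP => ij.
by apply: nci; apply: chain_trans cj.
Qed.

Lemma has_level_inj (m : L) (i j : int) :
  has_level m i -> has_level m j -> i = j.
Proof.
move=> mi mj; have := has_level_lt mi mj.1; have := has_level_lt mj mi.1.
by lia.
Qed.

(** The indices [j] with [c_ j <= m] form an initial segment of the integers;
    if it is neither empty nor full, climbing from an index inside to one
    outside passes its largest element [i - 1]. *)
Lemma levelP (m : L) :
  [\/ forall i, ~~ (c_ i <= m), exists i, has_level m i
    | forall i, c_ i <= m].
Proof.
have [all_c|/existsNP[j /negP ncj]] := pselect (forall i, c_ i <= m).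
  by constructor 3.
have [no_c|/existsNP[i /negP]] := pselect (forall i, ~~ (c_ i <= m)).
  by constructor 1.
rewrite negbK => ci; constructor 2.
have ij : i <= j.
  by rewrite leNgt; apply: contra ncj => /ltW ji; apply: chain_trans ci.
have {ij} jE : j = (i + `|j - i|%N%:Z)%R by lia.
move: ncj; rewrite jE; elim: `|j - i|%N => [|n IHn].
  by rewrite GRing.addr0 ci.
have [cn ncn1|ncn _] := boolP (c_ (i + n%:Z)%R <= m); last exact: IHn.
exists (i + n.+1%:Z)%R; split=> //.
by have -> : (i + n.+1%:Z - 1)%R = (i + n%:Z)%R by lia.
Qed.

(** An infimum [-oo] of the indices incomparable with [x] means that no [c_ i]
    lies below [x], as such an [i] would bound these indices from below. *)
Lemma A1P (x : L) :
  A1 c_ x <-> (forall i, ~~ (c_ i <= x)) /\ (exists i, ~~ (x <= c_ i)).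
Proof.
split=> [[[i xi] [_ inf_x]]|[no_c [i nxi]]].
  split; last first.
    exists i; move: xi; rewrite /incomparable_set /= /Order.comparable.
    by rewrite negb_or => /andP[].
  move=> j; apply/negP => cj.
  have /inf_x : lbound (EFin @` [set k : int | incomparable_set (c_ k) x])
      (j%:E)%E.
    move=> _ [k xk <-]; rewrite lee_fin leNgt; apply/negP => /ltW kj.
    move: xk; rewrite /incomparable_set /= /Order.comparable negb_or.
    by rewrite (chain_trans kj cj) andbF.
  by [].
have incomp (k : int) : k <= i -> incomparable_set (c_ k) x.
  move=> ki; rewrite /incomparable_set /= /Order.comparable negb_or no_c andbT.
  by apply: contra nxi => /le_trans; apply; apply: chain_mono.
split; first by exists i; apply: incomp.
split=> [y _|y lby]; first exact: leNye.
case: y lby => [r lby||//].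
- have /lby : (EFin @` [set k : int | incomparable_set (c_ k) x])
      ((Order.min i (r - 1)%R)%:E)%E.
    exists (Order.min i (r - 1)%R) => //; apply: incomp.
    by rewrite ge_min lexx.
  by rewrite lee_fin; lia.
- move=> lby.
  have /lby : (EFin @` [set k : int | incomparable_set (c_ k) x]) (i%:E)%E.
    by exists i => //; apply: incomp.
  by [].
Qed.

(** * The ordinal sum in terms of levels *)

Variables (c : L) (T_ : int -> L -> L -> L).
Hypothesis c_inf : infimums (range c_) c.
Hypothesis T_tnorm : forall i : int, is_tnorm_on (c_ (i - 1)%R) (c_ i) (T_ i).

Lemma c_lb i : c <= c_ i.
Proof. by case: c_inf => + _; apply; exists i. Qed.

Lemma c_glb x : (forall i, x <= c_ i) -> x <= c.
Proof. by move=> xc; case: c_inf => _; apply=> _ [i _ <-]. Qed.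

(** The top element is set apart because it must be neutral even where the
    meet is not above any [c_ i] and the general formula would cut it down to
    [c].  The default index [0] is never used: by [levelP], an index is only
    looked up when the meet has a level. *)
Definition level_sum (x y : L) : L :=
  if x == \top then y else if y == \top then x else
  let m := x `&` y in
  if `[< forall i, c_ i <= m >] then m
  else if `[< forall i, ~~ (c_ i <= m) >] then m `&` c
  else let i := xget 0%R (has_level m) in T_ i (x `&` c_ i) (y `&` c_ i).

Lemma level_sum_topl x : level_sum \top x = x.
Proof. by rewrite /level_sum eqxx. Qed.

Lemma level_sum_topr x : level_sum x \top = x.
Proof. by rewrite /level_sum eqxx; case: eqP. Qed.

Lemma level_sum_above x y : (forall i, c_ i <= x `&` y) ->
  level_sum x y = x `&` y.
Proof.
rewrite /level_sum => all_c.
have [->|_] := eqVneq x \top; first by rewrite meet1x.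
have [->|_] := eqVneq y \top; first by rewrite meetx1.
by rewrite asboolT.
Qed.

Lemma level_sum_below x y : x != \top -> y != \top ->
  (forall i, ~~ (c_ i <= x `&` y)) -> level_sum x y = x `&` y `&` c.
Proof.
move=> /negPf x1 /negPf y1 no_c; rewrite /level_sum x1 y1.
case: asboolP => [/(_ 0%R)|_]; first by rewrite (negPf (no_c _)).
by rewrite asboolT.
Qed.

Lemma level_sum_at i x y : x != \top -> y != \top -> has_level (x `&` y) i ->
  level_sum x y = T_ i (x `&` c_ i) (y `&` c_ i).
Proof.
move=> /negPf x1 /negPf y1 mi; rewrite /level_sum x1 y1.
case: asboolP => [/(_ i)|_]; first by rewrite (negPf mi.2).
case: asboolP => [/(_ (i - 1)%R)|_]; first by rewrite mi.1.
by case: xgetP => [j _ mj|/(_ i)//]; rewrite (has_level_inj mj mi).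
Qed.

Lemma trunc_itv i x : c_ (i - 1)%R <= x ->
  x `&` c_ i \in `[c_ (i - 1)%R, c_ i].
Proof. by move=> cx; rewrite in_itv /= lexI cx chain_pred_le leIr. Qed.

Lemma local_tnorm_top i x : x \in `[c_ (i - 1)%R, c_ i] -> T_ i x (c_ i) = x.
Proof.
move=> xi; rewrite (tnormC (T_tnorm i)) ?(tnorm1 (T_tnorm i)) //.
by rewrite in_itv /= lexx chain_pred_le.
Qed.

Lemma local_tnorm_trunc i x y : c_ (i - 1)%R <= x `&` y ->
  c_ (i - 1)%R <= T_ i (x `&` c_ i) (y `&` c_ i) <= x `&` y `&` c_ i.
Proof.
rewrite lexI => /andP[cx cy].
have xi := trunc_itv cx; have yi := trunc_itv cy; apply/andP; split.
  by have := tnorm_closed (T_tnorm i) xi yi; rewrite in_itv /= => /andP[].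
apply: le_trans (tnorm_leI (chain_pred_le i) (T_tnorm i) xi yi) _.
by rewrite meetACA meetxx.
Qed.

(** Neighbouring squares share a corner; both adjacent t-norms take the value
    of the corner there, which makes the first clause consistent. *)
Lemma level_sum_chain i : level_sum (c_ i) (c_ i) = c_ i.
Proof.
have [ci1|ci1] := eqVneq (c_ i) \top; first by rewrite ci1 level_sum_topl.
have [no_c|[j mj]|all_c] := levelP (c_ i `&` c_ i).
- by move: (no_c i); rewrite meetxx lexx.
- rewrite (level_sum_at ci1 ci1 mj).
  have ij : i < j by apply: has_level_lt mj _; rewrite meetxx.
  have cE : c_ i = c_ (j - 1)%R.
    apply/le_anti; rewrite chain_mono ?andTb; last by lia.
    by case: mj; rewrite meetxx.
  rewrite cE (meet_idPl (chain_pred_le j)).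
  exact: tnorm_lower_end (chain_pred_le j) (T_tnorm j).
- by rewrite level_sum_above // meetxx.
Qed.

Lemma square_level_sum i x y : square c_ i (x, y) -> level_sum x y = T_ i x y.
Proof.
rewrite /square /= => -[/=]; rewrite !in_itv /= => xi yi.
have xI : x \in `[c_ (i - 1)%R, c_ i] by rewrite in_itv.
have yI : y \in `[c_ (i - 1)%R, c_ i] by rewrite in_itv.
move: xi yi => /andP[cx xc] /andP[cy yc].
have [x1|x1] := eqVneq x \top.
  have ci1 : c_ i = \top by apply/eqP; rewrite -le1x -x1.
  by rewrite x1 level_sum_topl -ci1 (tnorm1 (T_tnorm i)).
have [y1|y1] := eqVneq y \top.
  have ci1 : c_ i = \top by apply/eqP; rewrite -le1x -y1.
  by rewrite y1 level_sum_topr -ci1 local_tnorm_top.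
have [|nci] := boolP (c_ i <= x `&` y).
  rewrite lexI => /andP[cix ciy].
  have -> : x = c_ i by apply/le_anti; rewrite xc.
  have -> : y = c_ i by apply/le_anti; rewrite yc.
  by rewrite level_sum_chain local_tnorm_top // in_itv /= lexx chain_pred_le.
rewrite (@level_sum_at i) // ?(meet_idPl xc) ?(meet_idPl yc) //.
by split=> //; rewrite lexI cx.
Qed.

Lemma lt1_neq (x : L) : (x < \top) = (x != \top).
Proof. by rewrite lt_neqAle lex1 andbT. Qed.

Lemma A2P i x : A2 c_ i x <-> c_ (i - 1)%R <= x /\ x >< c_ i.
Proof.
rewrite /A2 /incomparable_set set_itvE /=; split=> [[/andP[/ltW cx _] xi]//|].
move=> [cx xi]; split=> //; rewrite lt1_neq lt_neqAle cx andbT.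
apply/andP; split; apply: contraNneq xi.
  by move=> <-; rewrite /Order.comparable chain_pred_le.
by move=> ->; rewrite /Order.comparable lex1 orbT.
Qed.

Lemma A2_neq1 i x : A2 c_ i x -> x != \top.
Proof.
by rewrite /A2 set_itvE /= lt1_neq => -[/andP[]].
Qed.

Lemma A2_has_level i x y : A2 c_ i x -> c_ (i - 1)%R <= y ->
  has_level (x `&` y) i.
Proof.
move=> /A2P[cx xi] cy; split; first by rewrite lexI cx.
by apply: contra xi; rewrite lexI /Order.comparable => /andP[->]; rewrite orbT.
Qed.

Lemma Delta2_level_sum i x y : Delta2 c_ i (x, y) ->
  level_sum x y = T_ i (x `&` c_ i) (y `&` c_ i).
Proof.
rewrite /Delta2 set_itvE => -[[/= xA /andP[cy]]|[/= /andP[cx + yA]]];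
  rewrite lt1_neq => top.
- by apply: level_sum_at => //; [exact: A2_neq1 xA|exact: A2_has_level].
- apply: level_sum_at => //; first exact: A2_neq1 yA.
  by rewrite meetC; exact: A2_has_level.
Qed.

Lemma A1_neq1 x : A1 c_ x -> x != \top.
Proof. by move=> /A1P[no_c _]; apply: contraNneq (no_c 0%R) => ->. Qed.

Lemma Delta1_level_sum x y : Delta1 c_ (x, y) ->
  level_sum x y = x `&` y `&` c.
Proof.
rewrite /Delta1 set_itvE => -[[/= xA /andP[_]]|[/= /andP[_ + yA]]];
  rewrite lt1_neq => top.
- apply: level_sum_below => //; first exact: A1_neq1.
  by move=> i; rewrite lexI negb_and; case/A1P: xA => ->.
- apply: level_sum_below => //; first exact: A1_neq1.
  by move=> i; rewrite lexI negb_and orbC; case/A1P: yA => ->.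
Qed.

Lemma otherwise_level_sum x y :
  ~ (exists i, square c_ i (x, y)) -> ~ (exists i, Delta2 c_ i (x, y)) ->
  ~ Delta1 c_ (x, y) -> level_sum x y = x `&` y.
Proof.
move=> nsq nD2 nD1.
have [->|x1] := eqVneq x \top; first by rewrite level_sum_topl meet1x.
have [->|y1] := eqVneq y \top; first by rewrite level_sum_topr meetx1.
have [no_c|[i [cm ncm]]|all_c] := levelP (x `&` y).
- rewrite level_sum_below //; apply/meet_idPl.
  have bounded z : ~ A1 c_ z -> (forall i, ~~ (c_ i <= z)) -> z <= c.
    move=> nA no_cz; apply: c_glb => i; apply/negP => /negP nzi.
    by apply: nA; apply/A1P; split=> //; exists i.
  have nAx : ~ A1 c_ x.
    move=> xA; apply: nD1; left; split=> //=.
    by rewrite in_itv /= lt1_neq le0x.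
  have nAy : ~ A1 c_ y.
    move=> yA; apply: nD1; right; split=> //=.
    by rewrite in_itv /= lt1_neq le0x.
  have [no_cx|/existsNP[i /negP]] := pselect (forall i, ~~ (c_ i <= x)).
    by apply: leIxl; apply: bounded.
  rewrite negbK => cix; apply: leIxr; apply: bounded => // j; apply/negP => cjy.
  (* the smaller index would bound both [x] and [y] from below *)
  have := no_c (Order.min i j); rewrite lexI.
  by rewrite (chain_trans _ cix) ?(chain_trans _ cjy) // ge_min lexx ?orbT.
- rewrite (@level_sum_at i) //.
  move: cm; rewrite lexI => /andP[cx cy].
  have xcomp : (x <= c_ i) || (c_ i <= x).
    apply/negP => /negP xi; apply: nD2; exists i; left; split=> /=.
      exact/A2P.
    by rewrite in_itv /= lt1_neq cy.
  have ycomp : (y <= c_ i) || (c_ i <= y).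
    apply/negP => /negP yi; apply: nD2; exists i; right; split=> /=.
      by rewrite in_itv /= lt1_neq cx.
    exact/A2P.
  have xI := trunc_itv cx; have yI := trunc_itv cy.
  have [cix|ncix] := boolP (c_ i <= x).
    rewrite (meet_idPr cix) (tnorm1 (T_tnorm i)) //.
    have yci : y <= c_ i.
      by move: ncm ycomp; rewrite lexI cix /= => /negPf ->; rewrite orbF.
    by rewrite (meet_idPl yci) (meet_idPr (le_trans yci cix)).
  have xci : x <= c_ i by move: xcomp; rewrite (negPf ncix) orbF.
  have ciy : c_ i <= y.
    have [yci|//] := orP ycomp; case: nsq; exists i.
    by split; rewrite /= in_itv /= ?cx ?cy.
  by rewrite (meet_idPr ciy) local_tnorm_top // (meet_idPl xci)
             (meet_idPl (le_trans xci ciy)).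
- exact: level_sum_above.
Qed.

Lemma level_sum_ordinal_sum : is_ordinal_sum c_ c T_ level_sum.
Proof.
split.
- exact: square_level_sum.
- exact: Delta2_level_sum.
- exact: Delta1_level_sum.
- exact: otherwise_level_sum.
Qed.

Lemma ordinal_sum_uniq (T : L -> L -> L) :
  is_ordinal_sum c_ c T_ T -> level_sum = T.
Proof.
move=> sumT; have sumF := level_sum_ordinal_sum.
apply: funext => x; apply: funext => y.
have [[i sq]|nsq] := pselect (exists i, square c_ i (x, y)).
  by rewrite (ordinal_sum_square sumF sq) (ordinal_sum_square sumT sq).
have [[i D2]|nD2] := pselect (exists i, Delta2 c_ i (x, y)).
  by rewrite (ordinal_sum_Delta2 sumF D2) (ordinal_sum_Delta2 sumT D2).
have [D1|nD1] := pselect (Delta1 c_ (x, y)).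
  by rewrite (ordinal_sum_Delta1 sumF D1) (ordinal_sum_Delta1 sumT D1).
by rewrite (ordinal_sum_otherwise sumF) // (ordinal_sum_otherwise sumT).
Qed.

(** * The t-norm axioms *)

Lemma level_sum_leI x y : level_sum x y <= x `&` y.
Proof.
have [->|x1] := eqVneq x \top; first by rewrite level_sum_topl meet1x.
have [->|y1] := eqVneq y \top; first by rewrite level_sum_topr meetx1.
have [no_c|[i mi]|all_c] := levelP (x `&` y).
- by rewrite level_sum_below // leIl.
- rewrite (level_sum_at x1 y1 mi).
  by have /andP[_ /le_trans->] := local_tnorm_trunc mi.1; rewrite ?leIl.
- by rewrite level_sum_above.
Qed.

Lemma cle_level_sum i x y : (c_ i <= level_sum x y) = (c_ i <= x `&` y).
Proof.
apply/idP/idP => [/le_trans->//|ci]; first exact: level_sum_leI.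
have [->|x1] := eqVneq x \top.
  by rewrite level_sum_topl (le_trans ci) ?leIr.
have [->|y1] := eqVneq y \top.
  by rewrite level_sum_topr (le_trans ci) ?leIl.
have [no_c|[j mj]|all_c] := levelP (x `&` y).
- by move: (no_c i); rewrite ci.
- rewrite (level_sum_at x1 y1 mj).
  have /andP[+ _] := local_tnorm_trunc mj.1; apply: chain_trans.
  by have := has_level_lt mj ci; lia.
- by rewrite level_sum_above.
Qed.

(** When [c_ i <= x `&` y], both sides are [c_ i]: the level of the meet need
    not be [i] itself, which is what makes this usable for the inner operand of
    a nested sum. *)
Lemma level_sum_trunc i x y : x != \top -> y != \top ->
  c_ (i - 1)%R <= x `&` y ->
  level_sum x y `&` c_ i = T_ i (x `&` c_ i) (y `&` c_ i).
Proof.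
move=> x1 y1 cm; have [cim|ncim] := boolP (c_ i <= x `&` y).
  have ciF : c_ i <= level_sum x y by rewrite cle_level_sum.
  move: cim; rewrite lexI => /andP[cix ciy].
  rewrite (meet_idPr ciF) (meet_idPr cix) (meet_idPr ciy) local_tnorm_top //.
  by rewrite in_itv /= lexx chain_pred_le.
rewrite (@level_sum_at i) //; apply/meet_idPl.
by have /andP[_ /le_trans->] := local_tnorm_trunc cm; rewrite ?leIr.
Qed.

Lemma level_sum_meet_c x y : level_sum x y `&` c = x `&` y `&` c.
Proof.
have above i : c_ i <= x `&` y -> level_sum x y `&` c = x `&` y `&` c.
  move=> cm; have cF : c_ i <= level_sum x y by rewrite cle_level_sum.
  rewrite (meet_idPr (le_trans (c_lb i) cF)).
  by rewrite (meet_idPr (le_trans (c_lb i) cm)).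
have [->|x1] := eqVneq x \top; first by rewrite level_sum_topl meet1x.
have [->|y1] := eqVneq y \top; first by rewrite level_sum_topr meetx1.
have [no_c|[i [cm _]]|all_c] := levelP (x `&` y).
- by rewrite level_sum_below //; apply/meet_idPl; exact: leIr.
- exact: above cm.
- exact: above (all_c 0%R).
Qed.

Lemma level_sumC x y : level_sum x y = level_sum y x.
Proof.
have [->|x1] := eqVneq x \top; first by rewrite level_sum_topl level_sum_topr.
have [->|y1] := eqVneq y \top; first by rewrite level_sum_topl level_sum_topr.
have mC := meetC y x.
have [no_c|[i mi]|all_c] := levelP (x `&` y).
- by rewrite !level_sum_below // ?mC // => i; rewrite mC.
- have mi' : has_level (y `&` x) i by rewrite mC.
  rewrite (level_sum_at x1 y1 mi) (level_sum_at y1 x1 mi').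
  case: mi; rewrite lexI => /andP[cx cy] _.
  by rewrite (tnormC (T_tnorm i)) // trunc_itv.
- by rewrite !level_sum_above ?mC // => i; rewrite mC.
Qed.

Lemma level_sum_neq1 x y : x != \top -> level_sum x y != \top.
Proof.
apply: contraNneq => F1; rewrite -le1x -F1.
by rewrite (le_trans (level_sum_leI _ _)) ?leIl.
Qed.

(** The inner sum may be governed by another level than the outer one, but
    truncation makes only the level of [x `&` y `&` z] count.  By commutativity
    the same formulas describe the other bracketing, for [y], [z], [x]. *)
Lemma level_sum_nested x y z : x != \top -> y != \top -> z != \top ->
  [/\ (forall i, ~~ (c_ i <= x `&` y `&` z)) ->
        level_sum (level_sum x y) z = x `&` y `&` z `&` c,
      forall i, has_level (x `&` y `&` z) i ->
        level_sum (level_sum x y) z =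
        T_ i (T_ i (x `&` c_ i) (y `&` c_ i)) (z `&` c_ i)
    & (forall i, c_ i <= x `&` y `&` z) ->
        level_sum (level_sum x y) z = x `&` y `&` z].
Proof.
move=> x1 y1 z1; have F1 := level_sum_neq1 y x1.
have cleF i : (c_ i <= level_sum x y `&` z) = (c_ i <= x `&` y `&` z).
  by rewrite lexI cle_level_sum -lexI.
split=> [no_c|i [cm ncm]|all_c].
- rewrite level_sum_below // => [|i]; last by rewrite cleF.
  by rewrite [LHS]meetAC level_sum_meet_c [LHS]meetAC.
- rewrite (@level_sum_at i) //; last by rewrite /has_level !cleF.
  by rewrite level_sum_trunc // (le_trans cm) ?leIl.
- rewrite level_sum_above => [|i]; last by rewrite cleF.
  rewrite level_sum_above // => i.
  by rewrite (le_trans (all_c i)) ?leIl.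
Qed.

Lemma level_sumA x y z :
  level_sum (level_sum x y) z = level_sum x (level_sum y z).
Proof.
have [->|x1] := eqVneq x \top; first by rewrite !level_sum_topl.
have [->|y1] := eqVneq y \top; first by rewrite level_sum_topl level_sum_topr.
have [->|z1] := eqVneq z \top; first by rewrite !level_sum_topr.
rewrite [RHS]level_sumC.
have [below at_ above] := level_sum_nested x1 y1 z1.
have [below' at' above'] := level_sum_nested y1 z1 x1.
have mE : y `&` z `&` x = x `&` y `&` z by rewrite meetC meetA.
have [no_c|[i mi]|all_c] := levelP (x `&` y `&` z).
- by rewrite below // below' mE.
- rewrite (at_ _ mi) (at' i) ?mE //.
  case: mi; rewrite !lexI => /andP[/andP[cx cy] cz] _.
  have xi := trunc_itv cx; have yi := trunc_itv cy; have zi := trunc_itv cz.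
  rewrite (tnormA (T_tnorm i)) // (tnormC (T_tnorm i)) //.
  exact: (tnorm_closed (T_tnorm i)).
- by rewrite above // above' mE.
Qed.

Lemma level_sum_le x y z : x <= y -> level_sum x z <= level_sum y z.
Proof.
move=> xy; have [y1|y1] := eqVneq y \top.
  by rewrite y1 level_sum_topl (le_trans (level_sum_leI _ _)) ?leIr.
have x1 : x != \top by apply: contraNneq y1 => x1; rewrite -le1x -x1.
have [->|z1] := eqVneq z \top; first by rewrite !level_sum_topr.
have xzyz : x `&` z <= y `&` z by rewrite leI2.
have [no_c|[i mi]|all_c] := levelP (x `&` z).
- rewrite level_sum_below // (le_trans (leI2 xzyz (lexx c))) //.
  by rewrite -level_sum_meet_c leIl.
- have cmy : c_ (i - 1)%R <= y `&` z by apply: le_trans mi.1 xzyz.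
  (* truncating the right-hand side at [c_ i] also covers a higher level of
     [y `&` z] *)
  rewrite (le_trans _ (leIl _ (c_ i))) // level_sum_trunc //.
  rewrite (level_sum_at x1 z1 mi).
  case: mi cmy; rewrite !lexI => /andP[cx cz] _ /andP[cy _].
  by apply: (tnorm_le (T_tnorm i)); rewrite ?trunc_itv // leI2.
- rewrite !level_sum_above // => i.
  exact: le_trans xzyz.
Qed.

Lemma level_sum_tnorm : is_tnorm level_sum.
Proof.
split.
- by move=> x y _ _; rewrite in_itv /= le0x lex1.
- by move=> x y _ _; exact: level_sumC.
- by move=> x y z _ _ _; exact: level_sum_le.
- by move=> x y z _ _ _; exact: level_sumA.
- by move=> x _; exact: level_sum_topl.
Qed.

End LevelSum.

Theorem theorem3p5 (d : Order.disp_t) (L : tbLatticeType d)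
    (completeL : complete_lattice L)
    (c_ : int -> L) (c_le : forall i : int, c_ i <= c_ (i + 1)%R)
    (c : L) (c_inf : infimums (range c_) c)
    (T_ : int -> L -> L -> L)
    (T_tnorm : forall i : int, is_tnorm_on (c_ (i - 1)%R) (c_ i) (T_ i)) :
  (exists! T : L -> L -> L, is_ordinal_sum c_ c T_ T) /\
  (forall T : L -> L -> L, is_ordinal_sum c_ c T_ T -> is_tnorm T).
Proof.
have uniqT := @ordinal_sum_uniq _ _ _ c_le _ _ c_inf T_tnorm.
split=> [|T /uniqT <-]; last exact: level_sum_tnorm.
by exists (level_sum c_ c T_); split=> //; exact: level_sum_ordinal_sum.
Qed.
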